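(* Assume one of the following four settings: (i) $\mathfrak{D}'=\mathfrak{D}$ and $R\in\mathfrak{D}$; (ii) $\mathfrak{T}_a\subseteq\mathfrak{D}'\subseteq\mathfrak{D}$ and $R\in\mathfrak{T}_a$; (iii) $\mathfrak{D}'=\mathfrak{P}$ and $R\in\mathfrak{P}$; (iv) $\mathfrak{D}'=\mathfrak{P}^*$ and $R\in\mathfrak{P}^*$. Let $S\in\mathfrak{D}$, and let $\mathcal{E}(R),\mathcal{E}(S)$ be the EV-systems of $R$ and $S$ with respect to $\mathfrak{D}'$. Let $\rho$ be a strong S-scheme from $R$ to $S$ with respect to $\mathfrak{D}'$ such that, for all $G,H\in\mathfrak{D}'$, $\xi\in\mathcal{S}(G,R)$, $\zeta\in\mathcal{S}(H,R)$, $v\in V(G)$, $w\in V(H)$, $$\alpha^R_{G,\xi}(v)=\alpha^R_{H,\zeta}(w)\ \Longrightarrow\ \alpha^S_{G,\rho_G(\xi)}(v)=\alpha^S_{H,\rho_H(\zeta)}(w).$$ Put $\epsilon:=\alpha^S_{\mathcal{E}(R),\,\rho_{\mathcal{E}(R)}(\phi_R)}$. Then: - $\epsilon$ is a one-to-one map; - $\epsilon$ induces $\rho$, i.e. $\rho_G(\xi)=\phi_S\circ\epsilon\circ\alpha^R_{G,\xi}$ for all $G\in\mathfrak{D}'$ and $\xi\in\mathcal{S}(G,R)$; - $\epsilon$ fulfills Condition 1, i.e. $\alpha^S_{G,\rho_G(\xi)}=\epsilon\circ\alpha^R_{G,\xi}$ for all $G\in\mathfrak{D}'$ and $\xi\i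n\mathcal{S}(G,R)$.
   Context: Digraphs $G=(V(G),A(G))$ have a finite nonempty vertex set and $A(G)\subseteq V(G)\times V(G)$; loops are allowed, and $vw$ denotes $(v,w)$. An arc $vw$ is proper if $v\neq w$, and $G^*$ is $G$ with loops removed. For $v\in V(G)$: - $N_G(v)$ is the set of $w\neq v$ adjacent to $v$; - $N^{in}_G(v)=\{w\in N_G(v):wv\in A(G)\}$ and $N^{out}_G(v)=\{w\in N_G(v):vw\in A(G)\}$. A homomorphism maps arcs to arcs; it is strict if, in addition, it maps proper arcs to proper arcs. $\mathcal{S}(G,H)$ is the set of strict homomorphisms $G\to H$. Classes of digraphs: - $\mathfrak{D}$ is a representative system of the isomorphism classes of finite digraphs; constructed digraphs are identified with their representatives. - $\mathfrak{T}_a=\{G\in\mathfrak{D}:G^*\text{ has no closed walk}\}$. - $\mathfrak{P}$ is the set of posets (reflexive, antisymmetric, transitive) in $\mathfrak{D}$. - $\mathfrak{P}^*=\{P^*:P\in\mathfrak{P}\}$. An S-scheme from $R$ to $S$ with respect to $\mathfrak{D}'$ is a family of maps $\rho_G:\mathcal{S}(G,R)\to\mathcal{S}(G,S)$, $G\in\mathfrak{D}'$. It is strong if each $\rho_G$ is injective. EV-system of a digraph $T$ with respect to $\mathfrak{D}'$: - Vertex set $\mathcal{E}_o(T)=\{(v,D,U): v\in V(T),\ D\subseteq N^{in}_T(v),\ U\subseteq N^{out}_T(v)\}$. For $\mathfrak{a}\in\mathcal{E}_o(T)$ its components are $\mathfrak{a}_1,\mathfrak{a}_2,\mathfrak{a}_3$.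 - $\phi_T(\mathfrak{a})=\mathfrak{a}_1$. - For $G\in\mathfrak{D}'$ and $\xi\in\mathcal{S}(G,T)$, $\alpha^T_{G,\xi}:V(G)\to\mathcal{E}_o(T)$ is given by $v\mapsto(\xi(v),\xi[N^{in}_G(v)],\xi[N^{out}_G(v)])$. - The arc set of $\mathcal{E}(T)$ consists of all $\mathfrak{a}\mathfrak{b}$ for which there exist $G\in\mathfrak{D}'$, $\xi\in\mathcal{S}(G,T)$ and $vw\in A(G)$ with $\mathfrak{a}=\alpha^T_{G,\xi}(v)$ and $\mathfrak{b}=\alpha^T_{G,\xi}(w)$. In each of the four settings, $\mathcal{E}(R)\in\mathfrak{D}'$, and $\phi_R$ is a strict homomorphism $\mathcal{E}(R)\to R$, so $\rho_{\mathcal{E}(R)}(\phi_R)$ and $\epsilon$ are defined. *)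

(* Defs.v *)
From HB Require Import structures.
From mathcomp Require Import all_boot.
From mathcomp Require Import boolp.

Set Implicit Arguments.
Unset Strict Implicit.
Unset Printing Implicit Defensive.

Record digraph := Digraph {
  vert :> finType;
  arc : rel vert;
  vert_gt0 : 0 < #|vert| }.

Definition parc (G : digraph) : rel G := fun v w => (v != w) && arc v w.

(* the digraph G^* obtained from G by removing the loops *)
Definition strip (G : digraph) : digraph := Digraph (@parc G) (vert_gt0 G).

Definition nbh (G : digraph) (v : G) : {set G} :=
  [set w | (w != v) && (arc v w || arc w v)].
Definition nbh_in (G : digraph) (v : G) : {set G} :=
  [set w in nbh v | arc w v].
Definition nbh_out (G : digraph) (v : G) : {set G} :=
  [set w in nbh v | arc v w].

Definition homomorphism (G H : digraph) (f : G -> H) : bool :=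
  [forall v, forall w, arc v w ==> arc (f v) (f w)].
Definition strict_hom (G H : digraph) (f : G -> H) : bool :=
  homomorphism f && [forall v, forall w, parc v w ==> parc (f v) (f w)].

Record shom (G H : digraph) := Shom {
  shom_fun :> {ffun G -> H};
  shomP : strict_hom shom_fun }.

Record iso (G H : digraph) := Iso {
  iso_fun :> G -> H;
  iso_inv : H -> G;
  iso_funK : cancel iso_fun iso_inv;
  iso_invK : cancel iso_inv iso_fun;
  iso_arc : forall v w, arc (iso_fun v) (iso_fun w) = arc v w }.

(* A representative system of the isomorphism classes of finite digraphs,
   together with the isomorphisms that identify each digraph with its
   representative *)
Record rep_system := RepSystem {
  rep : digraph -> digraph;
  rep_iso : forall G, iso (rep G) G;
  rep_unique : forall G H, inhabited (iso G H) -> rep G = rep H }.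

(* Closed walks have positive length: [:: v] is the walk v, v *)
Definition acyclic (G : digraph) : Prop :=
  forall p : seq (strip G), p != [::] -> ~~ cycle (@arc (strip G)) p.
Definition poset (G : digraph) : Prop :=
  [/\ reflexive (@arc G), antisymmetric (@arc G) & transitive (@arc G)].

Definition frakD (X : rep_system) (G : digraph) : Prop :=
  exists H, G = rep X H.
Definition frakTa (X : rep_system) (G : digraph) : Prop :=
  frakD X G /\ acyclic G.
Definition frakP (X : rep_system) (G : digraph) : Prop :=
  frakD X G /\ poset G.
Definition frakPstar (X : rep_system) (G : digraph) : Prop :=
  exists2 P, frakP X P & G = rep X (strip P).

Definition setting (X : rep_system) (D' : digraph -> Prop) (R : digraph) :
    Prop :=
  [\/ D' = frakD X /\ frakD X R,
      [/\ forall G, frakTa X G -> D' G, forall G, D' G -> frakD X G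
        & frakTa X R],
      D' = frakP X /\ frakP X R |
      D' = frakPstar X /\ frakPstar X R].

Definition Sscheme (D' : digraph -> Prop) (R S : digraph) : Type :=
  forall G, D' G -> shom G R -> shom G S.
Definition strong (D' : digraph -> Prop) (R S : digraph) (rho : Sscheme D' R S) :=
  forall G (hG : D' G), injective (rho G hG).

Definition EVvert (T : digraph) : finType :=
  {a : T * {set T} * {set T} |
    (a.1.2 \subset nbh_in a.1.1) && (a.2 \subset nbh_out a.1.1)}.

Definition EV1 (T : digraph) (a : EVvert T) : T := (val a).1.1.
Definition EV2 (T : digraph) (a : EVvert T) : {set T} := (val a).1.2.
Definition EV3 (T : digraph) (a : EVvert T) : {set T} := (val a).2.

Lemma shom_arc (G H : digraph) (f : shom G H) v w : arc v w -> arc (f v) (f w).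
Proof.
by case/andP: (shomP f) => /forallP/(_ v)/forallP/(_ w)/implyP.
Qed.

Lemma shom_parc (G H : digraph) (f : shom G H) v w :
  parc v w -> parc (f v) (f w).
Proof.
by case/andP: (shomP f) => _ /forallP/(_ v)/forallP/(_ w)/implyP.
Qed.

Lemma in_nbh_in (G : digraph) (v w : G) : (w \in nbh_in v) = parc w v.
Proof. by rewrite !inE /parc; case: (arc w v); rewrite ?orbT ?andbT ?andbF. Qed.

Lemma in_nbh_out (G : digraph) (v w : G) : (w \in nbh_out v) = parc v w.
Proof.
by rewrite !inE /parc eq_sym; case: (arc v w); rewrite /= ?andbT ?andbF.
Qed.

Lemma alpha_subproof (T G : digraph) (xi : shom G T) (v : G) :
  ((xi v, xi @: nbh_in v, xi @: nbh_out v).1.2 \subset nbh_in (xi v)) &&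
  ((xi v, xi @: nbh_in v, xi @: nbh_out v).2 \subset nbh_out (xi v)).
Proof.
apply/andP; split; apply/subsetP => _ /imsetP[w hw ->].
  by move: hw; rewrite !in_nbh_in; apply: shom_parc.
by move: hw; rewrite !in_nbh_out; apply: shom_parc.
Qed.

Definition alpha (T G : digraph) (xi : shom G T) (v : G) : EVvert T :=
  exist _ (xi v, xi @: nbh_in v, xi @: nbh_out v) (alpha_subproof xi v).

Definition EVarc (D' : digraph -> Prop) (T : digraph) : rel (EVvert T) :=
  fun a b => `[< exists (G : digraph) (xi : shom G T) (v w : G),
    [/\ D' G, arc v w, a = alpha xi v & b = alpha xi w] >].

Lemma EVvert_gt0 (T : digraph) : 0 < #|EVvert T|.
Proof.
case/card_gt0P: (vert_gt0 T) => v _; apply/card_gt0P.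
have h : ((v, set0, set0 : {set T}).1.2 \subset nbh_in v) &&
  ((v, set0 : {set T}, set0).2 \subset nbh_out v).
  by rewrite !sub0set.
by exists (exist _ (v, set0, set0) h).
Qed.

Definition EV (D' : digraph -> Prop) (T : digraph) : digraph :=
  Digraph (@EVarc D' T) (EVvert_gt0 T).

Lemma strict_homI (G H : digraph) (f : G -> H) :
  (forall v w, arc v w -> arc (f v) (f w)) ->
  (forall v w, parc v w -> parc (f v) (f w)) -> strict_hom f.
Proof.
by move=> h1 h2; apply/andP; split; apply/forallP => v; apply/forallP => w;
  apply/implyP; [apply: h1 | apply: h2].
Qed.

Lemma shomI (G H : digraph) (f : G -> H) :
  (forall v w, arc v w -> arc (f v) (f w)) ->
  (forall v w, parc v w -> parc (f v) (f w)) ->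
  strict_hom [ffun v => f v].
Proof. by move=> h1 h2; apply: strict_homI => v w; rewrite !ffunE; auto. Qed.

Lemma phi_subproof (D' : digraph -> Prop) (T : digraph) :
  strict_hom [ffun a : EV D' T => EV1 a : T].
Proof.
have harc (a b : EV D' T) : arc a b -> arc (EV1 a : T) (EV1 b).
  by move=> /asboolP[G [xi [v [w [_ hvw -> ->]]]]]; apply: shom_arc.
apply: shomI => // a b /andP[hab].
move=> /asboolP[G [xi [v [w [_ hvw ha hb]]]]].
have hp : parc v w.
  by rewrite /parc hvw andbT; apply: contraNneq hab => e; rewrite ha hb e.
by rewrite ha hb; apply: (shom_parc xi hp).
Qed.

Definition phi (D' : digraph -> Prop) (T : digraph) : shom (EV D' T) T :=
  Shom (phi_subproof D' T).

Lemma iso_parc (G H : digraph) (i : iso G H) v w : parc (i v) (i w) = parc v w.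
Proof. by rewrite /parc iso_arc (can_eq (iso_funK i)). Qed.

Lemma shom_iso_subproof (G H T : digraph) (i : iso G H) (xi : shom H T) :
  strict_hom [ffun v : G => xi (i v)].
Proof.
apply: shomI => v w h; first by apply: shom_arc; rewrite iso_arc.
by apply: shom_parc; rewrite iso_parc.
Qed.

Definition shom_iso (G H T : digraph) (i : iso G H) (xi : shom H T) :
  shom G T := Shom (shom_iso_subproof i xi).

(* The lemmas below lead to EV_mem: in each of the four settings the
   representative of E(R) belongs to D' *)

Lemma iso_sym (G H : digraph) : iso G H -> iso H G.
Proof. by case=> f g fK gK h; exists g f => // v w; rewrite -h !gK. Qed.

Lemma iso_trans (G H K : digraph) : iso G H -> iso H K -> iso G K.
Proof.
case=> f g fK gK h [f' g' fK' gK' h']; exists (f' \o f) (g \o g').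
- exact: can_comp.
- exact: can_comp.
- by move=> v w /=; rewrite h' h.
Qed.

Lemma iso_strip (G H : digraph) : iso G H -> iso (strip G) (strip H).
Proof.
move=> i; apply: (@Iso (strip G) (strip H) i (iso_inv i)) => [||v w].
- exact: (iso_funK i).
- exact: (iso_invK i).
- exact: (iso_parc i).
Qed.

Lemma frakD_rep (X : rep_system) (G : digraph) : frakD X (rep X G).
Proof. by exists G. Qed.

Lemma EV_eq (T : digraph) (a b : EVvert T) :
  EV1 a = EV1 b -> EV2 a = EV2 b -> EV3 a = EV3 b -> a = b.
Proof.
move=> h1 h2 h3; apply: val_inj; move: h1 h2 h3; rewrite /EV1 /EV2 /EV3.
by case: (val a) => [[? ?] ?]; case: (val b) => [[? ?] ?] /= -> -> ->.
Qed.

Lemma alpha_iso (T G H : digraph) (i : iso G H) (xi : shom H T) v :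
  alpha (shom_iso i xi) v = alpha xi (i v).
Proof.
apply: EV_eq; rewrite /EV1 /EV2 /EV3 /= ?ffunE //.
  apply/setP => x; apply/imsetP/imsetP => -[w hw ->].
    by exists (i w); rewrite ?ffunE //; move: hw; rewrite !in_nbh_in iso_parc.
  exists (iso_inv i w); last by rewrite ffunE iso_invK.
  by move: hw; rewrite !in_nbh_in -(iso_parc i) iso_invK.
apply/setP => x; apply/imsetP/imsetP => -[w hw ->].
  by exists (i w); rewrite ?ffunE //; move: hw; rewrite !in_nbh_out iso_parc.
exists (iso_inv i w); last by rewrite ffunE iso_invK.
by move: hw; rewrite !in_nbh_out -(iso_parc i) iso_invK.
Qed.

Lemma EVarcI (X : rep_system) (D' : digraph -> Prop) (T G : digraph)
    (xi : shom G T) v w :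
  D' (rep X G) -> arc v w -> EVarc D' (alpha xi v) (alpha xi w).
Proof.
move=> hG hvw; apply/asboolP; pose i := rep_iso X G.
exists (rep X G), (shom_iso i xi), (iso_inv i v), (iso_inv i w).
by split; rewrite ?alpha_iso ?iso_invK // -(iso_arc i) !iso_invK.
Qed.

Lemma acyclic_shom (G H : digraph) : shom G H -> acyclic H -> acyclic G.
Proof.
move=> f hH p p0; apply/negP => hp.
have /hH/negP : map (f : strip G -> strip H) p != [::] by case: (p) p0.
by apply; apply: homo_cycle hp => v w; exact: shom_parc.
Qed.

Lemma poset_iso (G H : digraph) : iso G H -> poset H -> poset G.
Proof.
move=> i [r a t]; split.
- by move=> v; rewrite -(iso_arc i).
- by move=> v w; rewrite -!(iso_arc i) => /a /(can_inj (iso_funK i)).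
- by move=> v w u; rewrite -!(iso_arc i); apply: t.
Qed.

Definition sposet (G : digraph) : Prop :=
  irreflexive (@arc G) /\ transitive (@arc G).

Lemma sposet_iso (G H : digraph) : iso G H -> sposet H -> sposet G.
Proof.
move=> i [r t]; split; first by move=> v; rewrite -(iso_arc i).
by move=> v w u; rewrite -!(iso_arc i); apply: t.
Qed.

Lemma sposet_parc (G : digraph) (v w : G) : sposet G -> parc v w = arc v w.
Proof.
move=> [r _]; rewrite /parc; case: eqP => // ->.
by rewrite r.
Qed.

Lemma poset_strip (G : digraph) : poset G -> sposet (strip G).
Proof.
move=> [r a t]; split=> [v | w v u]; rewrite /= /parc ?eqxx //.
move=> /andP[vw avw] /andP[wu awu]; rewrite (t _ _ _ avw awu) andbT.
by apply: contraNneq vw => vu; apply/eqP/a; rewrite avw vu.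
Qed.

Definition rclos (G : digraph) : digraph :=
  Digraph (fun v w : G => (v == w) || arc v w) (vert_gt0 G).

Lemma rclos_poset (G : digraph) : sposet G -> poset (rclos G).
Proof.
move=> [r t]; split=> [v | v w | w v u] /=; first by rewrite eqxx.
  case: eqP => //= _; case: eqP => [-> //|_] /= /andP[h1 h2].
  by move: (t _ _ _ h1 h2); rewrite r.
case: eqP => [-> //|_] /= h; case: eqP => [<-|_] /=; first by rewrite h orbT.
by move=> h'; rewrite (t _ _ _ h h') orbT.
Qed.

Lemma rclos_strip (G : digraph) : sposet G -> iso G (strip (rclos G)).
Proof.
move=> hG; apply: (@Iso G (strip (rclos G)) id id) => // v w.
rewrite /= /parc /=.
by rewrite -(sposet_parc _ _ hG) /parc; case: eqP.
Qed.

Lemma frakP_rep (X : rep_system) (G : digraph) : poset G -> frakP X (rep X G).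
Proof.
by split; [exact: frakD_rep | exact: poset_iso (rep_iso X G) _].
Qed.

Lemma frakPstar_rep (X : rep_system) (G : digraph) :
  sposet G -> frakPstar X (rep X G).
Proof.
move=> hG; exists (rep X (rclos G)); first exact/frakP_rep/rclos_poset.
apply: rep_unique; constructor; apply: iso_trans (rclos_strip hG) _.
exact/iso_strip/iso_sym/rep_iso.
Qed.

Lemma frakPstarP (X : rep_system) (G : digraph) : frakPstar X G -> sposet G.
Proof.
case=> P [_ hP] ->; apply: sposet_iso (rep_iso X _) _; exact: poset_strip.
Qed.

Definition EVlt (T : digraph) (a b : EVvert T) : bool :=
  [&& parc (EV1 a) (EV1 b), EV1 a \in EV2 b, EV2 a \subset EV2 b,
      EV1 b \in EV3 a & EV3 b \subset EV3 a].

Lemma EVlt_irr (T : digraph) : irreflexive (@EVlt T).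
Proof. by move=> a; rewrite /EVlt /parc eqxx. Qed.

Lemma EVlt_trans (T : digraph) :
  transitive (@parc T) -> transitive (@EVlt T).
Proof.
move=> t b a c /and5P[h1 h2 h3 h4 h5] /and5P[k1 k2 k3 k4 k5].
apply/and5P; split.
- exact: t h1 k1.
- exact: (subsetP k3).
- exact: subset_trans h3 k3.
- exact: (subsetP h5).
- exact: subset_trans k5 h5.
Qed.

Lemma EVlt_alpha (T G : digraph) (xi : shom G T) v w :
  transitive (@parc G) -> parc v w -> EVlt (alpha xi v) (alpha xi w).
Proof.
move=> t h; apply/and5P; split; rewrite /EV1 /EV2 /EV3 /=.
- exact: shom_parc.
- by apply: imset_f; rewrite in_nbh_in.
- apply: imsetS; apply/subsetP => x; rewrite !in_nbh_in => hx; exact: t hx h.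
- by apply: imset_f; rewrite in_nbh_out.
- apply: imsetS; apply/subsetP => x; rewrite !in_nbh_out => hx; exact: t h hx.
Qed.

(* Strict orders whose vertices are pairs of a vertex of T and a tag, ordered
   by their tags *)
Definition tlt (s t : 'I_6) : bool :=
  (nat_of_ord s, nat_of_ord t) \in
    [:: (0, 1); (0, 2); (0, 3); (0, 5); (1, 2); (1, 3); (1, 5); (2, 3);
        (4, 2); (4, 3)].

Lemma tlt_irr : irreflexive tlt.
Proof. by move=> [[|[|[|[|[|[|s]]]]]] hs]. Qed.

Lemma tlt_trans : transitive tlt.
Proof.
by move=> [[|[|[|[|[|[|s]]]]]] hs] [[|[|[|[|[|[|t]]]]]] ht] [[|[|[|[|[|[|u]]]]]] hu].
Qed.

Lemma EV2_alphaP (T G : digraph) (xi : shom G T) v x :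
  reflect (exists2 w, parc w v & x = xi w) (x \in EV2 (alpha xi v)).
Proof.
by apply: (iffP imsetP) => -[w hw ->]; exists w; rewrite ?in_nbh_in // in hw *.
Qed.

Lemma EV3_alphaP (T G : digraph) (xi : shom G T) v x :
  reflect (exists2 w, parc v w & x = xi w) (x \in EV3 (alpha xi v)).
Proof.
by apply: (iffP imsetP) => -[w hw ->]; exists w; rewrite ?in_nbh_out // in hw *.
Qed.

Lemma tagged_real (T : digraph) (Q : pred (T * 'I_6)) (p0 : T * 'I_6) :
  Q p0 -> (forall p q, Q p -> Q q -> tlt p.2 q.2 -> parc p.1 q.1) ->
  exists (K : digraph) (xi : shom K T) (f : {p | Q p} -> K),
  [/\ sposet K,
      forall p q, arc (f p) (f q) = tlt (val p).2 (val q).2,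
      forall p, EV1 (alpha xi (f p)) = (val p).1,
      forall p x, (x \in EV2 (alpha xi (f p))) =
        [exists t, Q (x, t) && tlt t (val p).2] &
      forall p x, (x \in EV3 (alpha xi (f p))) =
        [exists t, Q (x, t) && tlt (val p).2 t]].
Proof.
move=> q0 hQ; pose V : finType := {p : T * 'I_6 | Q p}.
have V0 : 0 < #|V| by apply/card_gt0P; exists (exist _ p0 q0).
pose K := @Digraph V (fun p q => tlt (val p).2 (val q).2) V0.
have hK : sposet K by split=> [p | q p r]; [exact: tlt_irr | exact: tlt_trans].
have hs (p q : K) : arc p q -> parc (val p).1 (val q).1.
  by apply: hQ; exact: valP.
have hxi : strict_hom [ffun p : K => (val p).1].
  apply: shomI => p q; first by move=> /hs/andP[].
  by move=> /andP[_]; exact: hs.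
exists K, (Shom hxi), id; split=> // p; first by rewrite /EV1 /= ffunE.
  move=> x; apply/EV2_alphaP/existsP => [[q hq ->]|[t /andP[ht h]]].
    exists (val q).2; rewrite /= ffunE -surjective_pairing.
    apply/andP; split; first exact: valP.
    by move: hq; rewrite (sposet_parc _ _ hK).
  exists (exist _ (x, t) ht : K); last by rewrite /= ffunE.
  by rewrite (sposet_parc _ _ hK).
move=> x; apply/EV3_alphaP/existsP => [[q hq ->]|[t /andP[ht h]]].
  exists (val q).2; rewrite /= ffunE -surjective_pairing.
  apply/andP; split; first exact: valP.
    by move: hq; rewrite (sposet_parc _ _ hK).
exists (exist _ (x, t) ht : K); last by rewrite /= ffunE.
by rewrite (sposet_parc _ _ hK).
Qed.

Lemma EV2P (T : digraph) (a : EVvert T) x : x \in EV2 a -> parc x (EV1 a).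
Proof.
by rewrite -in_nbh_in; case/andP: (valP a) => /subsetP h _; exact: h.
Qed.

Lemma EV3P (T : digraph) (a : EVvert T) x : x \in EV3 a -> parc (EV1 a) x.
Proof.
by rewrite -in_nbh_out; case/andP: (valP a) => _ /subsetP h; exact: h.
Qed.

Lemma EV_star (T : digraph) (a : EVvert T) : transitive (@parc T) ->
  exists (K : digraph) (xi : shom K T) v, sposet K /\ a = alpha xi v.
Proof.
move=> tT; pose Q (p : T * 'I_6) : bool :=
  match nat_of_ord p.2 with
  | 0 => p.1 \in EV2 a | 1 => p.1 == EV1 a | 2 => p.1 \in EV3 a
  | _ => false end.
have q0 : Q (EV1 a, @Ordinal 6 1 isT) by rewrite /Q /=.
have [|K [xi [f [hK _ h1 h2 h3]]]] := tagged_real q0.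
  move=> [x [[|[|[|s]]] hs]] [y [[|[|[|t]]] ht]] //; rewrite /Q /=.
  - by move=> h /eqP-> _; exact: EV2P.
  - by move=> h k _; exact: tT (EV2P h) (EV3P k).
  - by move=> /eqP-> h _; exact: EV3P.
exists K, xi, (f (exist (fun p => is_true (Q p)) _ q0)); split=> //; apply: EV_eq; first by rewrite h1.
  apply/setP => x; rewrite h2 /=; apply/idP/existsP => [h|].
    by exists (@Ordinal 6 0 isT); rewrite /Q /= h.
  case=> -[[|[|[|s]]] hs]; rewrite /Q /tlt /= ?andbF // => /andP[] //.
apply/setP => x; rewrite h3 /=; apply/idP/existsP => [h|].
  by exists (@Ordinal 6 2 isT); rewrite /Q /= h.
case=> -[[|[|[|s]]] hs]; rewrite /Q /tlt /= ?andbF // => /andP[] //.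
Qed.

Lemma EVlt_real (T : digraph) (a b : EVvert T) :
  transitive (@parc T) -> EVlt a b ->
  exists (K : digraph) (xi : shom K T) v w,
    [/\ sposet K, arc v w, a = alpha xi v & b = alpha xi w].
Proof.
move=> tT /and5P[ab h1 /subsetP h2 k1 /subsetP k2].
pose Q (p : T * 'I_6) : bool :=
  match nat_of_ord p.2 with
  | 0 => p.1 \in EV2 a | 1 => p.1 == EV1 a | 2 => p.1 == EV1 b
  | 3 => p.1 \in EV3 b | 4 => p.1 \in EV2 b | _ => p.1 \in EV3 a end.
have q1 : Q (EV1 a, @Ordinal 6 1 isT) by rewrite /Q /=.
have q2 : Q (EV1 b, @Ordinal 6 2 isT) by rewrite /Q /=.
have [|K [xi [f [hK hf e1 e2 e3]]]] := tagged_real q1.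
  move=> [x [[|[|[|[|[|[|s]]]]]] hs]] [y [[|[|[|[|[|[|t]]]]]] ht]] //;
    rewrite /Q /=.
  - by move=> h /eqP-> _; exact: EV2P.
  - by move=> /h2 h /eqP-> _; exact: EV2P.
  - by move=> h /k2 k _; exact: tT (EV2P h) (EV3P k).
  - by move=> h k _; exact: tT (EV2P h) (EV3P k).
  - by move=> /eqP-> /eqP->.
  - by move=> /eqP-> /k2 k _; exact: EV3P.
  - by move=> /eqP-> k _; exact: EV3P.
  - by move=> /eqP-> k _; exact: EV3P.
  - by move=> h /eqP-> _; exact: EV2P.
  - by move=> h k _; exact: tT (EV2P h) (EV3P k).
exists K, xi, (f (exist (fun p => is_true (Q p)) _ q1)),
  (f (exist (fun p => is_true (Q p)) _ q2)); split=> //.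
- apply: EV_eq; rewrite ?e1 //; apply/setP => x.
    rewrite e2 /=; apply/idP/existsP => [h|].
      by exists (@Ordinal 6 0 isT); rewrite /Q /= h.
    by case=> -[[|[|[|[|[|[|s]]]]]] hs];
      rewrite /Q /tlt /= ?andbF // => /andP[].
  rewrite e3 /=; apply/idP/existsP => [h|].
    by exists (@Ordinal 6 5 isT); rewrite /Q /= h.
  case=> -[[|[|[|[|[|[|s]]]]]] hs];
    rewrite /Q /tlt /= ?andbF // => /andP[] // h _;
    first [exact: k2 | by rewrite (eqP h)].
- apply: EV_eq; rewrite ?e1 //; apply/setP => x.
    rewrite e2 /=; apply/idP/existsP => [h|].
      by exists (@Ordinal 6 4 isT); rewrite /Q /= h.
    case=> -[[|[|[|[|[|[|s]]]]]] hs];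
      rewrite /Q /tlt /= ?andbF // => /andP[] // h _;
      first [exact: h2 | by rewrite (eqP h)].
  rewrite e3 /=; apply/idP/existsP => [h|].
    by exists (@Ordinal 6 3 isT); rewrite /Q /= h.
  by case=> -[[|[|[|[|[|[|s]]]]]] hs];
    rewrite /Q /tlt /= ?andbF // => /andP[].
Qed.

Lemma nbh_parc (T G H : digraph) (xi : shom G T) (zeta : shom H T)
    (f : G -> H) (g : H -> G) v :
  cancel f g -> cancel g f ->
  (forall v w, parc (f v) (f w) = parc v w) -> (forall v, zeta (f v) = xi v) ->
  alpha zeta (f v) = alpha xi v.
Proof.
move=> fK gK hf hz; apply: EV_eq; rewrite /EV1 /EV2 /EV3 /= ?hz //.
  apply/setP => x; apply/imsetP/imsetP => -[w hw ->].
    by exists (g w); rewrite -?hz ?gK //; move: hw; rewrite !in_nbh_in -hf gK.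
  by exists (f w); rewrite ?hz //; move: hw; rewrite !in_nbh_in hf.
apply/setP => x; apply/imsetP/imsetP => -[w hw ->].
  by exists (g w); rewrite -?hz ?gK //; move: hw; rewrite !in_nbh_out -hf gK.
by exists (f w); rewrite ?hz //; move: hw; rewrite !in_nbh_out hf.
Qed.

Lemma rclos_shom (T K : digraph) (xi : shom K T) :
  reflexive (@arc T) -> sposet K ->
  exists zeta : shom (rclos K) T, forall v, alpha zeta v = alpha xi v.
Proof.
move=> rT hK.
have hp (v w : rclos K) : parc v w = @parc K v w.
  by rewrite /parc /=; case: eqP.
have h : strict_hom [ffun v : rclos K => xi v : T].
  apply: shomI => v w; last by rewrite hp; exact: shom_parc.
  by move=> /= /orP[/eqP->|]; [exact: rT | exact: shom_arc].
exists (Shom h) => v.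
by apply: (@nbh_parc T K (rclos K) xi (Shom h) id id) => // u; rewrite /= ffunE.
Qed.

Lemma poset_parc (G : digraph) : poset G -> transitive (@parc G).
Proof. by move=> /poset_strip[]. Qed.

Lemma sposet_parc_trans (G : digraph) : sposet G -> transitive (@parc G).
Proof. by move=> h v w u; rewrite !(sposet_parc _ _ h); case: h => _; apply. Qed.

Lemma EV_poset (X : rep_system) (T : digraph) :
  poset T -> poset (EV (frakP X) T).
Proof.
move=> hT; have tT := poset_parc hT; have [rT _ _] := hT.
have arcE (a b : EVvert T) : EVarc (frakP X) a b = (a == b) || EVlt a b.
  apply/idP/orP => [/asboolP[G [xi [v [w [[_ hG] vw -> ->]]]]] | [/eqP<-|h]].
  - have [<-|vw'] := eqVneq v w; [by left | right].
    by apply: EVlt_alpha; [exact: poset_parc | rewrite /parc vw'].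
  - have [K [xi [v [hK ->]]]] := EV_star a tT.
    have [zeta <-] := rclos_shom xi rT hK.
    by apply: (EVarcI (X := X)); [exact/frakP_rep/rclos_poset | rewrite /= eqxx].
  - have [K [xi [v [w [hK vw -> ->]]]]] := EVlt_real tT h.
    have [zeta hz] := rclos_shom xi rT hK; rewrite -!hz.
    apply: (EVarcI (X := X)); first exact/frakP_rep/rclos_poset.
    by rewrite /= vw orbT.
have hlt : sposet (@Digraph (EVvert T) (@EVlt T) (EVvert_gt0 T)).
  by split; [exact: EVlt_irr | exact: EVlt_trans].
have [r a t] := rclos_poset hlt.
split=> [x|x y|x y z]; rewrite /= !arcE; [exact: r | exact: a | exact: t].
Qed.

Lemma EV_sposet (X : rep_system) (T : digraph) :
  sposet T -> sposet (EV (frakPstar X) T).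
Proof.
move=> hT; have tT := sposet_parc_trans hT.
have arcE (a b : EVvert T) : EVarc (frakPstar X) a b = EVlt a b.
  apply/idP/idP => [/asboolP[G [xi [v [w [/frakPstarP hG vw -> ->]]]]] | h].
    by apply: EVlt_alpha; [exact: sposet_parc_trans | rewrite sposet_parc].
  have [K [xi [v [w [hK vw -> ->]]]]] := EVlt_real tT h.
  by apply: (EVarcI (X := X)) => //; exact: frakPstar_rep.
split=> [x|x y z]; rewrite /= !arcE; first exact: EVlt_irr.
exact: EVlt_trans.
Qed.

Lemma EV_mem (X : rep_system) (D' : digraph -> Prop) (R : digraph) :
  setting X D' R -> D' (rep X (EV D' R)).
Proof.
case=> [[-> _]|[hT _ [_ hR]]|[-> [_ hR]]|[-> /frakPstarP hR]].
- exact: frakD_rep.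
- apply: hT; split; first exact: frakD_rep.
  by apply: acyclic_shom hR; exact: shom_iso (rep_iso X _) (phi D' R).
- exact/frakP_rep/EV_poset.
- exact/frakPstar_rep/EV_sposet.
Qed.

(* phi_R, as a strict homomorphism on the representative of E(R) *)
Definition phi_rep (X : rep_system) (D' : digraph -> Prop) (R : digraph) :
    shom (rep X (EV D' R)) R :=
  shom_iso (rep_iso X (EV D' R)) (phi D' R).

Definition epsilon (X : rep_system) (D' : digraph -> Prop) (R S : digraph)
    (hR : setting X D' R) (rho : Sscheme D' R S) (a : EVvert R) : EVvert S :=
  alpha (rho (rep X (EV D' R)) (EV_mem hR) (phi_rep X D' R))
    (iso_inv (rep_iso X (EV D' R)) a).

Definition induces (D' : digraph -> Prop) (R S : digraph)
    (eps : EVvert R -> EVvert S) (rho : Sscheme D' R S) : Prop :=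
  forall G (hG : D' G) (xi : shom G R) (v : G),
    rho G hG xi v = phi D' S (eps (alpha xi v)).

Definition condition1 (D' : digraph -> Prop) (R S : digraph)
    (eps : EVvert R -> EVvert S) (rho : Sscheme D' R S) : Prop :=
  forall G (hG : D' G) (xi : shom G R) (v : G),
    alpha (rho G hG xi) v = eps (alpha xi v).

(* Main.v *)
Require Import Defs.
From mathcomp Require Import all_boot.
From mathcomp Require Import boolp.

(** If every vertex [a] of E(R) is of the form [alpha xi v] for some [G] in D',
then [alpha] of [phi_R] is the identity of E(R), and the hypothesis on [rho],
applied to [xi] and [phi_R], is Condition 1.  The realising digraph is a star:
a centre mapped to [a_1], in-leaves mapped onto [a_2] and out-leaves mapped
onto [a_3].

For injectivity, let [epsilon a = epsilon b].  The in-leaves of the stars of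
[a] and [b] have the same set [(epsilon a)_2] of images under [rho], and
likewise for the out-leaves.  Take the star whose leaves are the pairs of a
leaf of [a] and a leaf of [b] with equal images under [rho].  Its two
projections to R realise [a] and [b] at the centre and have the same image
under [rho], so they coincide since [rho] is injective. *)

Set Implicit Arguments.
Unset Strict Implicit.
Unset Printing Implicit Defensive.

(** * Transport along isomorphisms *)

Lemma iso_inv_arc (G H : digraph) (i : iso G H) (v w : H) :
  Defs.arc (iso_inv i v) (iso_inv i w) = Defs.arc v w.
Proof. by rewrite -(iso_arc i) !iso_invK. Qed.

(* Unlike [iso_sym], which is opaque, this has a known inverse map. *)
Definition iso_flip (G H : digraph) (i : iso G H) : iso H G :=
  Iso (iso_invK i) (iso_funK i) (iso_inv_arc i).

Lemma alpha_iso_inv (T G H : digraph) (i : iso G H) (xi : shom H T) v :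
  alpha (shom_iso i xi) (iso_inv i v) = alpha xi v.
Proof. by rewrite alpha_iso iso_invK. Qed.

Lemma EV1_alpha (T G : digraph) (xi : shom G T) v : EV1 (alpha xi v) = xi v.
Proof. by []. Qed.

Lemma shom_eq (G H : digraph) (xi zeta : shom G H) : xi =1 zeta -> xi = zeta.
Proof.
case: xi zeta => [f hf] [g hg] /= /ffunP e; move: hf hg; rewrite e => hf hg.
by rewrite (bool_irrelevance hf hg).
Qed.

(** * Stars and their strict homomorphisms to R *)

Section Star.

(* [tr] adds the arcs from in-leaves to out-leaves, [rf] adds all loops: the
   star is a strict order for [tr], and a poset for [tr] and [rf]. *)
Variables (tr rf : bool) (I J : finType).

(** [None] is the centre, [inl] marks the in-leaves and [inr] the out-leaves. *)
Definition star_parc (v w : option (I + J)) : bool :=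
  match v, w with
  | Some (inl _), None | None, Some (inr _) => true
  | Some (inl _), Some (inr _) => tr
  | _, _ => false
  end.

Lemma star_gt0 : 0 < #|{: option (I + J)}|.
Proof. by apply/card_gt0P; exists None. Qed.

Definition star : digraph :=
  Digraph (fun v w => rf && (v == w) || star_parc v w) star_gt0.

Lemma parc_star (v w : star) : parc v w = star_parc v w.
Proof.
rewrite /parc /=; have [<-|] := eqVneq v w; last by rewrite andbF.
by case: v => [[]|].
Qed.

Lemma star_parc_trans : tr -> transitive star_parc.
Proof. by move=> h [[?|?]|] [[?|?]|] [[?|?]|]. Qed.

Variable R : digraph.
Hypotheses (trP : tr -> transitive (@parc R)).
Hypotheses (rfP : rf -> reflexive (@Defs.arc R)).
Variables (f : I -> R) (g : J -> R) (c : R).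
Hypotheses (fP : forall i, parc (f i) c) (gP : forall j, parc c (g j)).

Definition star_fun (v : star) : R :=
  match v with
  | None => c | Some (inl i) => f i | Some (inr j) => g j
  end.

Lemma star_fun_parc v w : star_parc v w -> parc (star_fun v) (star_fun w).
Proof.
case: v w => [[i|j]|] [[i'|j']|] // h; [|exact: fP | exact: gP].
(* An arc from an in-leaf to an out-leaf: here [h] is [tr], and the two images are joined through
   [c]. *)
exact: trP h _ _ _ (fP i) (gP j').
Qed.

Lemma star_strict : strict_hom [ffun v => star_fun v].
Proof.
apply: shomI => v w; last by rewrite parc_star; exact: star_fun_parc.
move=> /= /orP[/andP[h /eqP->]|/star_fun_parc/andP[]//].
exact: rfP.
Qed.

Definition star_shom : shom star R := Shom star_strict.

Lemma star_shomE v : star_shom v = star_fun v.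
Proof. exact: ffunE. Qed.

(** Only the image sets of the leaves count, so several leaves may share an image; the stars on
    pairs of leaves rely on this. *)
Lemma star_centre (a : EVvert R) :
  c = EV1 a -> f @: setT = EV2 a -> g @: setT = EV3 a ->
  alpha star_shom None = a.
Proof.
move=> hc hf hg; apply: EV_eq; first by rewrite EV1_alpha star_shomE.
  rewrite -hf; apply/setP => x; apply/EV2_alphaP/imsetP => -[].
    move=> [[i|j]|]; rewrite ?parc_star // => _ ->.
    by exists i; rewrite ?star_shomE.
  by move=> i _ ->; exists (Some (inl i)); rewrite ?parc_star ?star_shomE.
rewrite -hg; apply/setP => x; apply/EV3_alphaP/imsetP => -[].
  move=> [[i|j]|]; rewrite ?parc_star // => _ ->.
  by exists j; rewrite ?star_shomE.
by move=> j _ ->; exists (Some (inr j)); rewrite ?parc_star ?star_shomE.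
Qed.

(** Apart from the image of the leaf, only [c] and the image set of the out-leaves enter. Leaves of
    stars with different index types can thus be compared. *)
Lemma star_in i :
  [/\ EV1 (alpha star_shom (Some (inl i))) = f i,
      EV2 (alpha star_shom (Some (inl i))) = set0 &
      EV3 (alpha star_shom (Some (inl i))) =
        c |: (if tr then g @: setT else set0)].
Proof.
split; first by rewrite EV1_alpha star_shomE.
  apply/setP => x; rewrite inE; apply/EV2_alphaP => -[].
  by move=> [[?|?]|]; rewrite parc_star.
apply/setP => x; rewrite !inE; apply/EV3_alphaP/orP => [[]|[/eqP->|]].
- move=> [[?|j]|]; rewrite parc_star //= => h ->; rewrite star_shomE /=.
    by right; rewrite h; apply: imset_f.
  by left.
- by exists None; rewrite ?parc_star ?star_shomE.
- case: ifP => [h /imsetP[j _ ->]|_]; last by rewrite inE.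
  by exists (Some (inr j)); rewrite ?parc_star ?star_shomE.
Qed.

Lemma star_out j :
  [/\ EV1 (alpha star_shom (Some (inr j))) = g j,
      EV2 (alpha star_shom (Some (inr j))) =
        c |: (if tr then f @: setT else set0) &
      EV3 (alpha star_shom (Some (inr j))) = set0].
Proof.
split; first by rewrite EV1_alpha star_shomE.
  apply/setP => x; rewrite !inE; apply/EV2_alphaP/orP => [[]|[/eqP->|]].
  - move=> [[i|?]|]; rewrite parc_star //= => h ->; rewrite star_shomE /=.
      by right; rewrite h; apply: imset_f.
    by left.
  - by exists None; rewrite ?parc_star ?star_shomE.
  - case: ifP => [h /imsetP[i _ ->]|_]; last by rewrite inE.
    by exists (Some (inl i)); rewrite ?parc_star ?star_shomE.
apply/setP => x; rewrite inE; apply/EV3_alphaP => -[].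
by move=> [[?|?]|]; rewrite parc_star.
Qed.

End Star.

Lemma star_sposet (I J : finType) : sposet (star true false I J).
Proof. by split=> [[[]|]|] //=; apply: star_parc_trans. Qed.

Lemma star_poset (I J : finType) : poset (star true true I J).
Proof.
suff -> : star true true I J = rclos (star true false I J).
  exact/rclos_poset/star_sposet.
(* The arc relations agree by computation; only the proofs of nonemptiness differ. *)
by rewrite /rclos /star /=; congr Digraph; apply: Prop_irrelevance.
Qed.

(** Plain stars serve settings (i) and (ii), reflexive transitive ones (iii), and irreflexive
    transitive ones (iv). In (ii), acyclicity is pulled back from R along the given homomorphism. *)
Lemma setting_star (X : rep_system) (D' : digraph -> Prop) (R : digraph) :
  setting X D' R ->
  exists tr rf : bool,
  [/\ tr -> transitive (@parc R), rf -> reflexive (@Defs.arc R) &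
    forall I J : finType, shom (star tr rf I J) R ->
      D' (rep X (star tr rf I J))].
Proof.
case=> [[-> _]|[hT _ [_ hR]]|[-> [_ hR]]|[-> /frakPstarP hR]].
- by exists false, false; split=> // I J _; exact: frakD_rep.
- exists false, false; split=> // I J xi; apply: hT; split.
    exact: frakD_rep.
  exact: acyclic_shom (shom_iso (rep_iso X _) xi) hR.
- exists true, true; split=> [_|_|I J _]; first exact: poset_parc.
    by case: hR.
  exact/frakP_rep/star_poset.
- exists true, false; split=> // [_|I J _]; first exact: sposet_parc_trans.
  exact/frakPstar_rep/star_sposet.
Qed.

(** * The star realising a given vertex of E(R) *)

Section StarOf.

Variables (tr rf : bool) (R : digraph).
Hypotheses (trP : tr -> transitive (@parc R)).
Hypotheses (rfP : rf -> reflexive (@Defs.arc R)).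

Lemma imset_val (T : finType) (A : {set T}) :
  (val : {x | x \in A} -> T) @: setT = A.
Proof.
apply/setP => x; apply/imsetP/idP => [[y _ ->]|h]; first exact: valP.
by exists (exist _ x h).
Qed.

Variable a : EVvert R.

Lemma EV2_val (x : {x | x \in EV2 a}) : parc (val x) (EV1 a).
Proof. exact/EV2P/valP. Qed.

Lemma EV3_val (x : {x | x \in EV3 a}) : parc (EV1 a) (val x).
Proof. exact/EV3P/valP. Qed.

Definition star_of : shom (star tr rf {x | x \in EV2 a} {x | x \in EV3 a}) R :=
  star_shom trP rfP EV2_val EV3_val.

Lemma star_of_centre : alpha star_of None = a.
Proof. by apply: star_centre; rewrite ?imset_val. Qed.

Lemma star_of_in x :
  [/\ EV1 (alpha star_of (Some (inl x))) = val x,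
      EV2 (alpha star_of (Some (inl x))) = set0 &
      EV3 (alpha star_of (Some (inl x))) =
        EV1 a |: (if tr then EV3 a else set0)].
Proof.
have [e1 e2 e3] := star_in trP rfP EV2_val EV3_val x.
by rewrite e1 e2 e3 imset_val.
Qed.

Lemma star_of_out x :
  [/\ EV1 (alpha star_of (Some (inr x))) = val x,
      EV2 (alpha star_of (Some (inr x))) =
        EV1 a |: (if tr then EV2 a else set0) &
      EV3 (alpha star_of (Some (inr x))) = set0].
Proof.
have [e1 e2 e3] := star_out trP rfP EV2_val EV3_val x.
by rewrite e1 e2 e3 imset_val.
Qed.

End StarOf.

(** An arc of E(R) at [a] comes from an arc of some digraph, so the other end has its first
    component in [EV2 a] or [EV3 a]. Conversely, the arcs at the centre of the star of [a] yield
    arcs of E(R) reaching all of these two sets. *)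
Lemma alpha_phi (X : rep_system) (D' : digraph -> Prop) (R : digraph)
    (a : EVvert R) :
  setting X D' R -> alpha (phi D' R) a = a.
Proof.
move=> /setting_star[tr [rf [trP rfP hD]]].
have [v va] : exists v, alpha (star_of trP rfP a) v = a.
  by exists None; exact: star_of_centre.
have hG := hD _ _ (star_of trP rfP a).
move: va hG; move: (star tr rf _ _) (star_of _ _ _) v => G xi v va hG.
(* The arc stays proper because [xi] is strict: already the first components differ. *)
have arcI u w : parc u w -> parc (alpha xi u : EV D' R) (alpha xi w).
  move=> huw; have /andP[_ uw] := huw; apply/andP; split; last first.
    exact: (EVarcI (X := X)).
  have /andP[+ _] := shom_parc xi huw; apply: contraNneq => e.
  by rewrite -!EV1_alpha e.
apply: EV_eq; first by rewrite EV1_alpha ffunE.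
  apply/setP => x; apply/EV2_alphaP/idP => [[b /andP[ba]]|].
    move=> /asboolP[H [ze [u [w [_ uw be ae]]]]] ->; rewrite ffunE be ae.
    apply/EV2_alphaP; exists u => //; rewrite /parc uw andbT.
    by apply: contraNneq ba => e; rewrite be ae e.
  rewrite -{1}va => /EV2_alphaP[u uv ->]; exists (alpha xi u).
    by rewrite -va; apply: arcI.
  by rewrite ffunE.
apply/setP => x; apply/EV3_alphaP/idP => [[b /andP[ab]]|].
  move=> /asboolP[H [ze [u [w [_ uw ae be]]]]] ->; rewrite ffunE be ae.
  apply/EV3_alphaP; exists w => //; rewrite /parc uw andbT.
  by apply: contraNneq ab => e; rewrite be ae e.
rewrite -{1}va => /EV3_alphaP[u vu ->]; exists (alpha xi u).
  by rewrite -va; apply: arcI.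
by rewrite ffunE.
Qed.

(** * Surjective projections of a fibre product *)

Section Matched.

Variables (I I' : finType) (T : eqType) (h : I -> T) (h' : I' -> T).

(** The fibre product of [h] and [h']. *)
Definition matched : finType := {p : I * I' | h p.1 == h' p.2}.

Lemma imset_matched_fst (U : finType) (f : I -> U) :
  (forall i, exists i', h i = h' i') ->
  (fun p : matched => f (val p).1) @: setT = f @: setT.
Proof.
move=> hh; apply/setP => x; apply/imsetP/imsetP => -[p _ ->].
  by exists (val p).1.
have [p' /eqP e] := hh p.
by exists (exist (fun q : I * I' => is_true (h q.1 == h' q.2)) (p, p') e).
Qed.

Lemma imset_matched_snd (U : finType) (f : I' -> U) :
  (forall i', exists i, h' i' = h i) ->
  (fun p : matched => f (val p).2) @: setT = f @: setT.
Proof.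
move=> hh; apply/setP => x; apply/imsetP/imsetP => -[p _ ->].
  by exists (val p).2.
have [p' /esym/eqP e] := hh p.
by exists (exist (fun q : I * I' => is_true (h q.1 == h' q.2)) (p', p) e).
Qed.

End Matched.

(** * Injectivity, for an abstract map [E] on EV-vertices *)

Section Injectivity.

(** [E] stands for [epsilon], and [P G] for membership of [rep X G] in D', so that stars need not be
    replaced by representatives. [E_shom] abstracts Condition 1, [E_inj] the injectivity of
    [rho]. *)
Variables (R S : digraph) (P : digraph -> Prop) (E : EVvert R -> EVvert S).
Hypothesis E_shom : forall G (xi : shom G R), P G ->
  exists eta : shom G S, forall v, alpha eta v = E (alpha xi v).
Hypothesis E_inj : forall G (xi zeta : shom G R), P G ->
  (forall v, EV1 (E (alpha xi v)) = EV1 (E (alpha zeta v))) -> xi = zeta.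

(** By [E_shom], the second component of [E (alpha xi v)] is the image of the in-neighbours of [v]
    under a homomorphism to S. *)
Lemma E_in G H (xi : shom G R) (zeta : shom H R) v v' w : P G -> P H ->
  E (alpha xi v) = E (alpha zeta v') -> parc w v ->
  exists2 w', parc w' v' & EV1 (E (alpha xi w)) = EV1 (E (alpha zeta w')).
Proof.
move=> /(E_shom xi)[eta e] /(E_shom zeta)[eta' e']; rewrite -e -e' => ev wv.
have : eta w \in EV2 (alpha eta v) by apply/EV2_alphaP; exists w.
rewrite ev => /EV2_alphaP[w' wv' ew]; exists w' => //.
by rewrite -e -e' !EV1_alpha.
Qed.

Lemma E_out G H (xi : shom G R) (zeta : shom H R) v v' w : P G -> P H ->
  E (alpha xi v) = E (alpha zeta v') -> parc v w ->
  exists2 w', parc v' w' & EV1 (E (alpha xi w)) = EV1 (E (alpha zeta w')).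
Proof.
move=> /(E_shom xi)[eta e] /(E_shom zeta)[eta' e']; rewrite -e -e' => ev vw.
have : eta w \in EV3 (alpha eta v) by apply/EV3_alphaP; exists w.
rewrite ev => /EV3_alphaP[w' vw' ew]; exists w' => //.
by rewrite -e -e' !EV1_alpha.
Qed.

Variables (tr rf : bool).
Hypotheses (trP : tr -> transitive (@parc R)).
Hypotheses (rfP : rf -> reflexive (@Defs.arc R)).
Hypothesis P_star : forall I J : finType,
  shom (star tr rf I J) R -> P (star tr rf I J).

(** The image in S of the vertex [v] of the star of [a], under any homomorphism that [E_shom]
    allows. *)
Let val1 a v := EV1 (E (alpha (star_of trP rfP a) v)).
Arguments val1 : clear implicits.

Lemma P_star_of (a : EVvert R) :
  P (star tr rf {x | x \in EV2 a} {x | x \in EV3 a}).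
Proof. exact: P_star (star_of trP rfP a). Qed.

Lemma leaf_in a b : E a = E b ->
  forall i, exists i', val1 a (Some (inl i)) = val1 b (Some (inl i')).
Proof.
have e0 : E a = E b ->
    E (alpha (star_of trP rfP a) None) = E (alpha (star_of trP rfP b) None).
  by rewrite !star_of_centre.
move=> /e0 /(E_in (P_star_of a) (P_star_of b)) h i.
have [|w'] := h (Some (inl i)); first by rewrite parc_star.
by case: w' => [[i'|i']|]; rewrite parc_star // => _ {}h; exists i'.
Qed.

Lemma leaf_out a b : E a = E b ->
  forall j, exists j', val1 a (Some (inr j)) = val1 b (Some (inr j')).
Proof.
have e0 : E a = E b ->
    E (alpha (star_of trP rfP a) None) = E (alpha (star_of trP rfP b) None).
  by rewrite !star_of_centre.
move=> /e0 /(E_out (P_star_of a) (P_star_of b)) h j.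
have [|w'] := h (Some (inr j)); first by rewrite parc_star.
by case: w' => [[j'|j']|]; rewrite parc_star // => _ {}h; exists j'.
Qed.

Lemma E_injective : injective E.
Proof.
move=> a b eab; have eba := esym eab.
pose I := matched (fun i => val1 a (Some (inl i)))
  (fun i => val1 b (Some (inl i))).
pose J := matched (fun j => val1 a (Some (inr j)))
  (fun j => val1 b (Some (inr j))).
have f1P (p : I) : parc (val (val p).1) (EV1 a) by apply/EV2P/valP.
have f2P (p : I) : parc (val (val p).2) (EV1 b) by apply/EV2P/valP.
have g1P (p : J) : parc (EV1 a) (val (val p).1) by apply/EV3P/valP.
have g2P (p : J) : parc (EV1 b) (val (val p).2) by apply/EV3P/valP.
pose xi := star_shom trP rfP f1P g1P; pose zeta := star_shom trP rfP f2P g2P.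
have If1 := imset_matched_fst val (leaf_in eab).
have If2 := imset_matched_snd val (leaf_in eba).
have Ig1 := imset_matched_fst val (leaf_out eab).
have Ig2 := imset_matched_snd val (leaf_out eba).
have xia : alpha xi None = a.
  by apply: star_centre; rewrite ?If1 ?Ig1 ?imset_val.
have zetab : alpha zeta None = b.
  by apply: star_centre; rewrite ?If2 ?Ig2 ?imset_val.
suff e : xi = zeta by rewrite -xia -zetab e.
(* A pair of leaves has under [xi] the same [alpha] as its first entry in the star of [a], and under
   [zeta] the same as its second in the star of [b]. The matching then equates the values of
   [val1]. *)
apply: E_inj => [|[[p|p]|]]; first exact: P_star.
- have -> : alpha xi (Some (inl p)) =
      alpha (star_of trP rfP a) (Some (inl (val p).1)).
    have [h1 h2 h3] := star_in trP rfP f1P g1P p.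
    have [k1 k2 k3] := star_of_in trP rfP (val p).1.
    by apply: EV_eq; rewrite ?h1 ?k1 ?h2 ?k2 ?h3 ?k3 ?Ig1 ?imset_val.
  have -> : alpha zeta (Some (inl p)) =
      alpha (star_of trP rfP b) (Some (inl (val p).2)).
    have [h1 h2 h3] := star_in trP rfP f2P g2P p.
    have [k1 k2 k3] := star_of_in trP rfP (val p).2.
    by apply: EV_eq; rewrite ?h1 ?k1 ?h2 ?k2 ?h3 ?k3 ?Ig2 ?imset_val.
  exact: eqP (valP p).
- have -> : alpha xi (Some (inr p)) =
      alpha (star_of trP rfP a) (Some (inr (val p).1)).
    have [h1 h2 h3] := star_out trP rfP f1P g1P p.
    have [k1 k2 k3] := star_of_out trP rfP (val p).1.
    by apply: EV_eq; rewrite ?h1 ?k1 ?h2 ?k2 ?h3 ?k3 ?If1 ?imset_val.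
  have -> : alpha zeta (Some (inr p)) =
      alpha (star_of trP rfP b) (Some (inr (val p).2)).
    have [h1 h2 h3] := star_out trP rfP f2P g2P p.
    have [k1 k2 k3] := star_of_out trP rfP (val p).2.
    by apply: EV_eq; rewrite ?h1 ?k1 ?h2 ?k2 ?h3 ?k3 ?If2 ?imset_val.
  exact: eqP (valP p).
- by rewrite xia zetab eab.
Qed.

End Injectivity.

Theorem theorem5 (X : rep_system) (D' : digraph -> Prop) (R S : digraph)
  (hR : setting X D' R) (hS : frakD X S)
  (rho : Sscheme D' R S) (rho_strong : strong rho)
  (rho_alpha : forall (G H : digraph) (hG : D' G) (hH : D' H)
     (xi : shom G R) (zeta : shom H R) (v : G) (w : H),
     alpha xi v = alpha zeta w ->
     alpha (rho G hG xi) v = alpha (rho H hH zeta) w) :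
  [/\ injective (epsilon hR rho),
      induces (epsilon hR rho) rho &
      condition1 (epsilon hR rho) rho].
Proof.
have cond1 : condition1 (epsilon hR rho) rho.
  (* Compare [xi] at [v] with [phi_rep] at the preimage of [alpha xi v]; [alpha_phi] makes the two
     [alpha] equal. *)
  move=> G hG xi v; apply: rho_alpha.
  by rewrite alpha_iso_inv (alpha_phi _ hR).
split=> //; last by move=> G hG xi v; rewrite ffunE -cond1.
have [tr [rf [trP rfP hD]]] := setting_star hR.
apply: (E_injective (P := fun G => D' (rep X G)) _ _ trP rfP hD) => [G xi hG|].
  (* Pull [xi] back to the representative, apply [rho] there, and return to [G]. *)
  exists (shom_iso (iso_flip (rep_iso X G))
    (rho _ hG (shom_iso (rep_iso X G) xi))) => v.
  by rewrite alpha_iso cond1 alpha_iso_inv.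
move=> G xi zeta hG e; apply: shom_eq => v.
(* Equality of the pullbacks to the representative, evaluated at the preimage of [v], gives equality
   at [v]. *)
suff /rho_strong/(congr1 (fun f : shom _ _ => f (iso_inv (rep_iso X G) v))) :
    rho _ hG (shom_iso (rep_iso X G) xi) =
    rho _ hG (shom_iso (rep_iso X G) zeta).
  by rewrite !ffunE iso_invK.
apply: shom_eq => u.
by rewrite -!EV1_alpha !cond1 !alpha_iso e.
Qed.
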